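(* Let $(P,\cdot)$ be a perm algebra over a field $k$ of characteristic $0$, let $\delta\in k$, and let $D$ be a $\delta$-derivation of $P$. Define a new multiplication on $P$ by $$a\circ b=D(a)b-aD(b).$$ Then $(P,\circ)$ is a Leibniz algebra, that is, $$(a\circ b)\circ c=a\circ(b\circ c)-b\circ(a\circ c)$$ for all $a,b,c\in P$.
   Context: A perm algebra is an associative algebra satisfying $(ab)c=(ba)c$. A linear map $D:P\to P$ is a $\delta$-derivation if $D(xy)=\delta\,(D(x)y+xD(y))$ for all $x,y\in P$. *)

(* Defs.v *)
From HB Require Import structures.
From mathcomp Require Import all_boot all_order all_algebra.

Set Implicit Arguments.
Unset Strict Implicit.
Unset Printing Implicit Defensive.

Import GRing.Theory.
Local Open Scope ring_scope.

(* Algebras here are not assumed unital (a unital perm algebra is commutative),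
   so an algebra is an [lmodType] together with a bilinear multiplication,
   rather than an [algType]. *)

Section NonUnitalAlgebras.

Variables (k : fieldType) (P : lmodType k).

Definition is_perm_algebra (mul : {bilinear P -> P -> P}) : Prop :=
  associative mul /\ (forall a b c, mul (mul a b) c = mul (mul b a) c).

Definition is_delta_derivation (mul : {bilinear P -> P -> P}) (delta : k)
    (D : {linear P -> P}) : Prop :=
  forall x y, D (mul x y) = delta *: (mul (D x) y + mul x (D y)).

Definition circ (mul : {bilinear P -> P -> P}) (D : {linear P -> P})
    (a b : P) : P :=
  mul (D a) b - mul a (D b).

(* Left Leibniz algebras; the product is a bare function, so that its
   bilinearity is part of the definition. *)
Definition is_leibniz_algebra (op : P -> P -> P) : Prop :=
  bilinear_for *:%R *:%R op /\
  forall a b c, op (op a b) c = op a (op b c) - op b (op a c).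

End NonUnitalAlgebras.

(* Main.v *)
(** Expanding D (a o b) makes the terms D(a) D(b) cancel, leaving
    delta (D^2(a) b - a D^2(b)).  Everything is then a combination of the
    products uvw of D-iterates of a, b, c in this order, since u v w = v u w,
    and the terms ab D^2(c) and D(a) D(b) c cancel between the two summands of
    the right-hand side. *)
Require Import Defs.
From HB Require Import structures.
From mathcomp Require Import all_boot all_order all_algebra.

Import GRing.Theory.
Local Open Scope ring_scope.

Lemma circ_bilinear (k : fieldType) (P : lmodType k)
    (mul : {bilinear P -> P -> P}) (D : {linear P -> P}) :
  bilinear_for *:%R *:%R (circ mul D).
Proof.
split=> z t x y; rewrite /circ /=.
  by rewrite linearP !linearPl /= scalerBr opprD addrACA.
by rewrite (linearP D) !linearPr /= scalerBr opprD addrACA.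
Qed.

Lemma derivation_circ {k : fieldType} {P : lmodType k}
    {mul : {bilinear P -> P -> P}} {delta : k} {D : {linear P -> P}}
    (hD : is_delta_derivation mul delta D) (a b : P) :
  D (circ mul D a b) = delta *: (mul (D (D a)) b - mul a (D (D b))).
Proof.
by rewrite /circ linearB !hD -scalerBr opprD addrA addrK.
Qed.

Theorem proposition6p1 (k : fieldType) (hk : [pchar k] =i pred0)
    (P : lmodType k) (mul : {bilinear P -> P -> P})
    (hP : is_perm_algebra mul)
    (delta : k) (D : {linear P -> P})
    (hD : is_delta_derivation mul delta D) :
  is_leibniz_algebra (circ mul D).
Proof.
split=> [|a b c]; first exact: circ_bilinear.
have [mulA mulCl] := hP.
(* The inner products stay folded so that [derivation_circ] applies to their images under [D]. *)
rewrite [LHS]/circ [in RHS]/circ -/(circ mul D b c) -/(circ mul D a c).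
rewrite !(derivation_circ hD) /circ !(linearZl_LR, linearZr_LR, linearBl, linearBr) /= !mulA.
(* Only the terms from [circ mul D b (circ mul D a c)] have their factors out of order. *)
rewrite (mulCl b (D (D a))) (mulCl b a) (mulCl (D b) (D a)) (mulCl (D b) a).
(* These four products survive: both sides come to [delta *: (X - Y) - (Z - W)]. *)
set X := mul (mul (D (D a)) b) c; set Y := mul (mul a (D (D b))) c.
set Z := mul (mul (D a) b) (D c); set W := mul (mul a (D b)) (D c).
(* Separates the multiples of [delta] from the rest; each group then telescopes by [subrKA]. *)
rewrite [in RHS]opprB [in RHS](addrC (_ - Z)) addrACA [in RHS](addrC (- _)).
by rewrite -scalerBr !opprB subrKA [in RHS](addrC (_ - Z)) subrKA.
Qed.
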